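(* Let $X=\{X_i,1\le i\le n\}$ be a centered Gaussian vector with invertible covariance matrix $C$, let $\sigma_i^2=\mathbb{E}X_i^2>0$ for each $1\le i\le n$, let $\underline{\gamma}=(\sigma_1^2,\ldots,\sigma_n^2)$, and let $1<p<\infty$. Let $\lambda_1,\ldots,\lambda_n$ be the positive reals defined as follows: $\underline{\mu}=(\mu_1,\ldots,\mu_n)$ are the eigenvalues of $C$, $U$ is an orthogonal matrix with ${}^tUCU=I(\underline{\mu})$, $W=U\,I(\underline{\mu}^{-1/2})$, $H={}^tW\,\big(p\,I(\underline{\gamma})\big)\,W$, and $V$ is a real matrix with ${}^tVV=I_n$ and ${}^tVHV=I(\lambda_1,\ldots,\lambda_n)$. Then $$\det\big(p\,I(\underline{\gamma})-C\big)=p^n\prod_{i=1}^n\sigma_i^2\Big(1-\frac{1}{\lambda_i}\Big).$$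
   Context: Notation: $I_n$ is the $n\times n$ identity matrix. For $\underline b=(b_1,\ldots,b_n)\in\mathbb{R}^n$, $I(\underline b)=I(b_1,\ldots,b_n)$ is the $n\times n$ diagonal matrix with diagonal entries $b_1,\ldots,b_n$; if all $b_i>0$ and $\alpha$ is real, $\underline b^{\alpha}=(b_1^{\alpha},\ldots,b_n^{\alpha})$. ${}^tM$ is the transpose of a matrix $M$. The covariance matrix is $C=(\mathbb{E}X_iX_j)_{1\le i,j\le n}$. *)

(* Defs.v *)
From HB Require Import structures.
From mathcomp Require Import all_boot all_order all_algebra.
From mathcomp Require Import all_classical all_reals all_analysis.
Set Implicit Arguments.
Unset Strict Implicit.
Unset Printing Implicit Defensive.
Import Order.TTheory GRing.Theory Num.Theory.
Import numFieldNormedType.Exports.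
Local Open Scope classical_set_scope.
Local Open Scope ring_scope.

(* The law of Y is N(m, s^2), where N(m, 0) is the point mass at m.  The two
   cases are separated because [normal_prob m 0] is not a Dirac mass but an
   unrelated default value. *)
Definition gaussian_rv (d : measure_display) (T : measurableType d)
    (R : realType) (P : probability T R) (Y : {RV P >-> R}) : Prop :=
  exists m s : R, 0 <= s /\
    forall A : set R, measurable A ->
      distribution P Y A = if s == 0 then \d_m A else normal_prob m s A.

Definition gaussian_vector (d : measure_display) (T : measurableType d)
    (R : realType) (P : probability T R) (n : nat)
    (X : 'I_n -> {RV P >-> R}) : Prop :=
  forall a : 'I_n -> R, gaussian_rv (P := P) (\sum_(i < n) a i *: (X i : {mfun T >-> R})).

Definition centered (d : measure_display) (T : measurableType d)
    (R : realType) (P : probability T R) (n : nat)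
    (X : 'I_n -> {RV P >-> R}) : Prop :=
  forall i : 'I_n, ('E_P[X i] = 0)%E.

(* For a centered vector E(X_i X_j) is the covariance of X_i and X_j. *)
Definition covariance_mx (d : measure_display) (T : measurableType d)
    (R : realType) (P : probability T R) (n : nat)
    (X : 'I_n -> {RV P >-> R}) : 'M[R]_n :=
  \matrix_(i < n, j < n) fine ('E_P[X i \* X j])%E.

Definition powR_row (R : realType) (n : nat) (b : 'rV[R]_n) (alpha : R) :
    'rV[R]_n :=
  \row_(i < n) (b 0 i `^ alpha).

Definition orthogonal_mx (R : realType) (n : nat) (M : 'M[R]_n) : Prop :=
  M^T *m M = 1%:M.

(* b lists all the eigenvalues of M, with multiplicity. *)
Definition eigenvalues_of (R : realType) (n : nat) (M : 'M[R]_n)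
    (b : 'rV[R]_n) : Prop :=
  char_poly M = \prod_(i < n) ('X - (b 0 i)%:P).

(* Main.v *)
Require Import Defs.
From HB Require Import structures.
From mathcomp Require Import all_boot all_order all_algebra.
From mathcomp Require Import all_classical all_reals all_analysis.
From mathcomp Require Import measurable_realfun ring lra.
Set Implicit Arguments.
Unset Strict Implicit.
Unset Printing Implicit Defensive.
Import Order.TTheory GRing.Theory Num.Theory.
Import numFieldNormedType.Exports.
Local Open Scope ring_scope.

(** The single matrix $M = WV$ diagonalises both forms by congruence: $W$ turns $C$ into the
    identity, which the orthogonal $V$ preserves, while $V$ makes $H$ diagonal. Hence
    ${}^tM(pI(\gamma)-C)M = I(\lambda_1-1,\ldots,\lambda_n-1)$, and comparing determinants with
    ${}^tM(pI(\gamma))M = I(\lambda)$ gives the factor $\prod_i(1-1/\lambda_i)$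
    ([det_sub_simultaneous_diag]). That $W$ whitens $C$ ([diag_mx_powR_whiten]) requires positive
    eigenvalues: they are nonnegative because a covariance matrix is positive semidefinite
    ([covariance_mx_psd]), and nonzero because $C$ is invertible. *)

(** Domination: $|XY| \le X^2 + Y^2$. *)
Lemma integrable_RV_mul (d : measure_display) (T : measurableType d)
    (R : realType) (P : probability T R) (X Y : {RV P >-> R}) :
  ('E_P[fun w => (X w ^+ 2)%R] < +oo)%E ->
  ('E_P[fun w => (Y w ^+ 2)%R] < +oo)%E ->
  P.-integrable setT (EFin \o (X \* Y)).
Proof.
move=> X2 Y2.
have sqr (Z : {RV P >-> R}) : ('E_P[fun w => (Z w ^+ 2)%R] < +oo)%E ->
    P.-integrable setT (EFin \o (fun w => Z w ^+ 2)).
  rewrite unlock => Z2; apply/integrableP; split.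
    by apply/measurable_EFinP; apply: measurable_funX.
  apply: le_lt_trans Z2; apply: ge0_le_integral => //.
  - apply/measurableT_comp => //; apply/measurable_EFinP.
    exact: measurable_funX.
  - by apply/measurable_EFinP; apply: measurable_funX.
  - by move=> w _; rewrite /= ger0_norm// sqr_ge0.
apply: (le_integrable measurableT _ _
  (integrableD measurableT (sqr _ X2) (sqr _ Y2))).
  by apply/measurable_EFinP; apply: measurable_funM.
move=> w _; rewrite /= lee_fin normrM.
rewrite [leRHS]ger0_norm ?addr_ge0 ?sqr_ge0//.
rewrite -[X w ^+ 2]real_normK ?num_real// -[Y w ^+ 2]real_normK ?num_real//.
have := normr_ge0 (X w); have := normr_ge0 (Y w); nra.
Qed.

(** The quadratic form equals $E(\sum_i a_i X_i)^2$; finite second moments allow the sum and the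
    integral to be exchanged. *)
Lemma covariance_mx_psd (d : measure_display) (T : measurableType d)
    (R : realType) (P : probability T R) (n : nat) (X : 'I_n -> {RV P >-> R})
    (a : 'I_n -> R) :
  (forall i, 'E_P[fun w => (X i w ^+ 2)%R] < +oo)%E ->
  0 <= \sum_i \sum_j a i * covariance_mx X i j * a j.
Proof.
move=> X2.
have intXX i j := integrable_RV_mul (X2 i) (X2 j).
(* Integrability ensures that [fine] does not replace an infinite value by 0. *)
have covE i j : (covariance_mx X i j)%:E = (\int[P]_w (X i w * X j w)%:E)%E.
  by rewrite mxE unlock fineK//; exact: integrable_fin_num (intXX i j).
rewrite -lee_fin pair_big -sumEFin.
under eq_bigr => k _ do
  rewrite mulrAC EFinM covE -integralZl ?intXX//.
rewrite -integral_sum//; last by move=> k; apply/integrableZl/intXX.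
apply: integral_ge0 => w _.
under eq_bigr do rewrite -EFinM.
rewrite sumEFin lee_fin.
rewrite (_ : \sum_k _ = (\sum_i a i * X i w) ^+ 2) ?sqr_ge0//.
rewrite expr2 big_distrlr/= pair_big/=.
by apply: eq_bigr => k _; rewrite mulrACA.
Qed.

Lemma diag_mx_powR_whiten (R : realType) (n : nat) (mu : 'rV[R]_n) :
  (forall i, 0 < mu 0 i) ->
  let D := diag_mx (powR_row mu (- 2^-1)) in D *m diag_mx mu *m D = 1%:M.
Proof.
move=> mu_gt0 /=; rewrite !mulmx_diag -diag_const_mx; congr diag_mx.
apply/rowP => i; rewrite !mxE mulrAC -powRD; last first.
  by rewrite (gt_eqF (mu_gt0 i)) implybT.
rewrite (_ : - 2^-1 - 2^-1 = -1 :> R); last by field.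
by rewrite powR_inv1 ?ltW// mulVf// gt_eqF.
Qed.

(* Taking determinants in the second hypothesis and in
   [M^T (D - C) M = diag (lambda - 1)], then eliminating [(det M)^2]. *)
Lemma det_sub_simultaneous_diag (R : fieldType) (n : nat) (C D M : 'M[R]_n)
    (lambda : 'rV[R]_n) :
  M^T *m C *m M = 1%:M -> M^T *m D *m M = diag_mx lambda -> \det D != 0 ->
  \det (D - C) = \det D * \prod_i (1 - 1 / lambda 0 i).
Proof.
move=> MC MD D0.
have detM0 : \det M != 0.
  apply/eqP => M0; move/(congr1 determinant)/eqP: MC.
  by rewrite !det_mulmx M0 mulr0 det1 eq_sym oner_eq0.
have detD : \det M ^+ 2 * \det D = \prod_i lambda 0 i.
  by rewrite -det_diag -MD !det_mulmx det_tr; ring.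
(* Nonvanishing of each [lambda 0 i] is what makes $\lambda_i(1-1/\lambda_i) = \lambda_i-1$ valid at
   the end. *)
have lambda0 i : lambda 0 i != 0.
  have : \prod_i lambda 0 i != 0 by rewrite -detD mulf_neq0// expf_neq0.
  by move/prodf_neq0 => /(_ i isT).
apply: (mulfI (expf_neq0 2 detM0)).
rewrite mulrA detD -big_split/=.
transitivity (\det (M^T *m (D - C) *m M)).
  by rewrite !det_mulmx det_tr; ring.
rewrite mulmxBr mulmxBl MC MD -diag_const_mx -raddfB det_diag.
by apply: eq_bigr => i _; rewrite !mxE mulrBr mulr1 mulrCA mul1r divff.
Qed.

Theorem mainTheorem2 (R : realType) (d : measure_display)
    (T : measurableType d) (P : probability T R) (n : nat)
    (X : 'I_n -> {RV P >-> R}) (C : 'M[R]_n) (sigma : 'I_n -> R)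
    (gamma mu lambda : 'rV[R]_n) (U W H V : 'M[R]_n) (p : R)
    (gaussX : gaussian_vector X) (centX : centered X)
    (C_def : C = covariance_mx X) (C_inv : C \in unitmx)
    (sigma_def : forall i : 'I_n, ((sigma i ^+ 2)%:E = 'E_P[fun w => (X i w ^+ 2)%R])%E)
    (sigma_gt0 : forall i : 'I_n, 0 < sigma i ^+ 2)
    (gamma_def : gamma = \row_(i < n) (sigma i ^+ 2))
    (p_gt1 : 1 < p)
    (mu_eigen : eigenvalues_of C mu)
    (U_orth : orthogonal_mx U) (U_diag : U^T *m C *m U = diag_mx mu)
    (W_def : W = U *m diag_mx (powR_row mu (- 2^-1)))
    (H_def : H = W^T *m (p *: diag_mx gamma) *m W)
    (V_orth : V^T *m V = 1%:M) (V_diag : V^T *m H *m V = diag_mx lambda) :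
  \det (p *: diag_mx gamma - C) =
    p ^+ n * \prod_(i < n) (sigma i ^+ 2 * (1 - 1 / lambda 0 i)).
Proof.
(* The second moments are finite because [sigma i] is a real number. *)
have X2 i : ('E_P[fun w => (X i w ^+ 2)%R] < +oo)%E by rewrite -sigma_def ltry.
(* Positivity of [mu] is essential: [x `^ r] is the junk value [1] for [x < 0],
   so [W] would then fail to whiten [C]. *)
have mu_ge0 i : 0 <= mu 0 i.
  (* [mu 0 i] is the quadratic form of $C$ at the $i$-th column of $U$. *)
  have -> : mu 0 i = \sum_j \sum_k U j i * C j k * U k i.
    transitivity ((U^T *m C *m U) i i); first by rewrite U_diag mxE eqxx.
    rewrite mxE exchange_big/=; apply: eq_bigr => k _.
    by rewrite mxE mulr_suml; apply: eq_bigr => j _; rewrite mxE.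
  by rewrite C_def; exact: covariance_mx_psd.
have mu_gt0 i : 0 < mu 0 i.
  rewrite lt_def mu_ge0 andbT.
  have : \det (diag_mx mu) != 0.
    rewrite -unitfE -unitmxE -U_diag !unitmx_mul unitmx_tr C_inv.
    by have [_ ->] := mulmx1_unit U_orth.
  by rewrite det_diag => /prodf_neq0 /(_ i isT).
have MC : (W *m V)^T *m C *m (W *m V) = 1%:M.
  have WCW : W^T *m C *m W = 1%:M.
    rewrite W_def trmx_mul tr_diag_mx -(diag_mx_powR_whiten mu_gt0) -U_diag.
    by rewrite !mulmxA.
  (* Write the target $I_n = {}^tVV$ as ${}^tV I_n V$, then expand the inner identity as
     ${}^tWCW$. *)
  by rewrite trmx_mul -V_orth -[X in _ = _ *m X]mul1mx -WCW !mulmxA.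
have MD : (W *m V)^T *m (p *: diag_mx gamma) *m (W *m V) = diag_mx lambda.
  by rewrite -V_diag H_def trmx_mul !mulmxA.
have detD : \det (p *: diag_mx gamma) = p ^+ n * \prod_i sigma i ^+ 2.
  rewrite detZ det_diag gamma_def; congr (_ * _).
  by apply: eq_bigr => i _; rewrite mxE.
have p_neq0 : p != 0 by rewrite gt_eqF// (lt_trans ltr01).
rewrite (det_sub_simultaneous_diag MC MD) detD.
  by rewrite -mulrA -big_split.
rewrite mulf_neq0 ?expf_neq0//.
by apply/prodf_neq0 => i _; rewrite gt_eqF.
Qed.
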